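(* Let $X=\{F=0\}\subset\mathbb P^N=\mathbb P(V)$ be a smooth quadric hypersurface defined by a real quadratic form $F$, and assume that its real locus $X^{\mathbb R}$ is nonempty. Then the set of values of $\Phi_X(Q)=\mathrm{EDdegree}_Q(X)$, as $Q$ ranges over the set $S^2_+V^{\mathbb R}$ of all inner products on $V^{\mathbb R}$, is $$\Phi_X(S_+^2V^{\mathbb R})=\{2,4,\dots,2N-2,2N\}.$$ In particular, $\min_{Q\in S_+^2V^{\mathbb R}}\Phi_X(Q)=2$.
   Context: $V\cong\mathbb C^{N+1}$ with real part $V^{\mathbb R}\cong\mathbb R^{N+1}$. An inner product is a positive definite symmetric bilinear form $Q$ on $V^{\mathbb R}$, extended complex bilinearly to $V$; $q(x)=Q(x,x)$. With $CX\subset V$ the affine cone over $X$, $\mathrm{EDdegree}_Q(X)$ is the number, for a general $u\in V$, of points $x\in(CX)_{\mathrm{sm}}$ with $Q(u-x,v)=0$ for all $v\in T_xCX$, i.e. of complex critical points of $x\mapsto q(u-x)$ on $(CX)_{\mathrm{sm}}$. *)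

(* Defs.v *)
From HB Require Import structures.
From mathcomp Require Import all_boot all_order all_algebra.
From mathcomp Require Import boolp classical_sets functions cardinality reals.
From mathcomp Require Import complex mpoly.

Set Implicit Arguments.
Unset Strict Implicit.
Unset Printing Implicit Defensive.

Import Order.TTheory GRing.Theory Num.Theory.

Local Open Scope classical_set_scope.
Local Open Scope ring_scope.

(* Coordinates: V^R is 'rV[R]_n and V is 'rV[R[i]]_n, with n = N + 1.         *)
(* A subset of P(V) is represented by its affine cone, a set of row vectors.  *)

Section AffineGeometry.
Variables (K : fieldType) (n : nat).
Implicit Types (F g : {mpoly K[n]}) (Z : set 'rV[K]_n) (x y v : 'rV[K]_n).

Definition zero_locus F : set 'rV[K]_n := [set x | F.@[x 0] = 0].

Definition gradient F x : 'rV[K]_n := \row_j (F^`M(j)).@[x 0].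

(* Jacobian criterion on P(V) for the scheme {F = 0}, F homogeneous *)
Definition smooth_hypersurface F :=
  forall x, x != 0 -> F.@[x 0] = 0 -> gradient F x != 0.

Definition vanishing_ideal Z : set {mpoly K[n]} :=
  [set g | forall x, Z x -> g.@[x 0] = 0].

Definition tangent_space Z x : set 'rV[K]_n :=
  [set v | forall g, vanishing_ideal Z g ->
             \sum_(j < n) gradient g x 0 j * v 0 j = 0].

(* The Jacobian of the ideal of Z at x has rank at least k, i.e.              *)
(* tangent_space Z x has codimension at least k.                              *)
Definition jacobian_rank_ge Z x (k : nat) :=
  exists2 G : 'I_k -> {mpoly K[n]},
    forall i, vanishing_ideal Z (G i) &
    row_free (\matrix_(i < k) gradient (G i) x).

(* For a variety Z all of whose components have the same dimension, the       *)
(* smooth points are those where the Jacobian rank is maximal on Z.           *)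
Definition smooth_locus Z : set 'rV[K]_n :=
  [set x | Z x /\ forall y k, Z y ->
             jacobian_rank_ge Z y k -> jacobian_rank_ge Z x k].

(* P holds on a nonempty Zariski open subset of K^n *)
Definition holds_generically (P : 'rV[K]_n -> Prop) :=
  exists2 D : {mpoly K[n]}, D != 0 & forall u : 'rV[K]_n, D.@[u 0] != 0 -> P u.

End AffineGeometry.

Definition bilin (K : fieldType) (n : nat) (Q : 'M[K]_n) (x y : 'rV[K]_n) : K :=
  (x *m Q *m y^T) 0 0.

Section EDdegree.
Variables (R : realType) (n : nat).
Implicit Types (Q : 'M[R]_n) (Z : set 'rV[R[i]]_n) (u : 'rV[R[i]]_n).

(* S^2_+ V^R, an inner product being given by its Gram matrix *)
Definition inner_products : set 'M[R]_n :=
  [set Q | Q^T = Q /\ forall x : 'rV[R]_n, x != 0 -> 0 < bilin Q x x].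

Definition complexify_form Q : 'M[R[i]]_n := map_mx (real_complex R) Q.

Definition complexify_poly (F : {mpoly R[n]}) : {mpoly R[i][n]} :=
  map_mpoly (real_complex R) F.

Definition ED_critical_points Q Z u : set 'rV[R[i]]_n :=
  [set x | smooth_locus Z x /\
     forall v, tangent_space Z x v -> bilin (complexify_form Q) (u - x) v = 0].

Definition is_EDdegree Q Z (d : nat) :=
  holds_generically (fun u => (ED_critical_points Q Z u #= `I_d)%card).

(* Z is the affine cone CX. The default value 0 is returned only if no number *)
(* satisfies is_EDdegree; at most one does.                                   *)
Definition EDdegree Q Z : nat := xget 0%N (is_EDdegree Q Z).

End EDdegree.

(* Main.v *)
Require Import Defs.
From HB Require Import structures.
From mathcomp Require Import all_boot all_order all_algebra.
From mathcomp Require Import boolp classical_sets functions cardinality reals.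
From mathcomp Require Import complex mpoly.
From mathcomp Require Import separable.
From mathcomp Require Import ring lra.

Set Implicit Arguments.
Unset Strict Implicit.
Unset Printing Implicit Defensive.

Import Order.TTheory GRing.Theory Num.Theory.

Local Open Scope classical_set_scope.
Local Open Scope ring_scope.

(** The EDdegree of a smooth quadric is controlled by a pencil of quadratic
    forms.  Write F(x) = x A x^T with A symmetric; smoothness makes A
    invertible.  The ideal of the cone CX has, at a nonzero point x, gradients
    that are all multiples of x A, so the critical points of the squared
    Q-distance to u are the nonzero x with x A x^T = 0 and
    (u - x) Q = l (x A) for some l ([ED_critical_points_quadric]).

    As Q is positive definite, a real change of coordinates turns Q into the
    identity and A into a diagonal matrix with real nonzero entries d_i
    ([simultaneous_diagonalization]).  Then x_i = w_i / (1 + l d_i), and the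
    equation of the quadric becomes an equation in l alone: with
    r_i = - 1 / d_i, l must be a root of
      P_w = \sum_i r_i w_i^2 \prod_(s != r_i) (X - s)^2,
    s running over the set of distinct r_i ([secular_poly]).  If there are m
    distinct values d_i, then P_w has degree 2 (m - 1), and for general w it is
    separable and has no root among the r_i ([generic_secular_separable],
    [separable_secular_root]); each root yields exactly one critical point, so
    that EDdegree_Q(X) = 2 (m - 1) ([EDdegree_real_quadric]).

    Separability for general w is a Bertini argument: the discriminant is a
    polynomial in w, hence it is enough to exhibit one w, and this is found in a
    pencil p + c q with p and q coprime, whose members are separable for all
    but finitely many c ([pencil_separable]).

    A real point of X is a nonzero isotropic vector, which forces the d_i to
    take both signs, so 2 <= m <= N + 1.  Conversely, rescaling the vectors of
    a diagonalizing basis amounts to changing Q and multiplies each d_i by an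
    arbitrary positive number, so only the signs of the d_i are constrained and
    every m in this range occurs ([EDdegree_attained]). *)

(** * Bilinear forms given by matrices *)

Section Bilin.
Variables (K : fieldType) (n : nat) (A : 'M[K]_n).
Implicit Types x y z : 'rV[K]_n.

Lemma bilinDl x y z : bilin A (x + y) z = bilin A x z + bilin A y z.
Proof. by rewrite /bilin !mulmxDl mxE. Qed.

Lemma bilinDr x y z : bilin A x (y + z) = bilin A x y + bilin A x z.
Proof. by rewrite /bilin linearD /= mulmxDr mxE. Qed.

Lemma bilinZl c x y : bilin A (c *: x) y = c * bilin A x y.
Proof. by rewrite /bilin -!scalemxAl mxE. Qed.

Lemma bilinZr c x y : bilin A x (c *: y) = c * bilin A x y.
Proof. by rewrite /bilin linearZ /= -scalemxAr mxE. Qed.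

Lemma bilinBl x y z : bilin A (x - y) z = bilin A x z - bilin A y z.
Proof. by rewrite -scaleN1r bilinDl bilinZl mulN1r. Qed.

Lemma bilinBr x y z : bilin A x (y - z) = bilin A x y - bilin A x z.
Proof. by rewrite -scaleN1r bilinDr bilinZr mulN1r. Qed.

Lemma bilinC x y : A^T = A -> bilin A x y = bilin A y x.
Proof.
move=> As; rewrite /bilin -[in RHS]As -[y in RHS]trmxK -!trmx_mul mulmxA.
by rewrite [RHS]mxE.
Qed.

End Bilin.

(** * Polynomial functions over a field of characteristic zero *)

(** A polynomial has finitely many roots and a field of characteristic zero is
    infinite. *)
Lemma poly_identically0 (K : numFieldType) (p : {poly K}) :
  (forall t, p.[t] = 0) -> p = 0.
Proof.
move=> p0; apply/eqP; apply: contraT => pN0.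
have uniq_s : uniq [seq (i%:R : K) | i <- iota 0 (size p)].
  by rewrite map_inj_uniq ?iota_uniq //; apply: mulrIn; rewrite oner_eq0.
have all_s : all (root p) [seq (i%:R : K) | i <- iota 0 (size p)].
  by apply/allP => t _; rewrite rootE p0.
by have := max_poly_roots pN0 all_s uniq_s; rewrite size_map size_iota ltnn.
Qed.

Lemma mpoly_ind_ring (K : comNzRingType) n (P : {mpoly K[n]} -> Prop) :
  (forall c, P c%:MP) -> (forall i, P 'X_i) ->
  (forall p q, P p -> P q -> P (p + q)) ->
  (forall p q, P p -> P q -> P (p * q)) -> forall p, P p.
Proof.
move=> PC PX PD PM; apply: mpolyind => [|c m p _ _ Pp].
  by rewrite -mpolyC0.
apply: (PD) Pp; rewrite -mul_mpolyC; apply: (PM) => //.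
rewrite mpolyXE_id; apply: big_ind => [||i _]; [exact: PC 1|exact: PM|].
by elim: (m i) => [|k IHk]; [exact: PC 1|rewrite exprS; apply: (PM)].
Qed.

(** First-order Taylor expansion along a parabola: the quadratic term does not
    see the second-order displacement w.  Both sides being compatible with sums
    and products, it is checked on constants and variables. *)
Lemma meval_parabola (K : fieldType) n (g : {mpoly K[n]}) (x v w : 'rV[K]_n) :
  exists p : {poly K}, forall t,
    g.@[(x + t *: v + t ^+ 2 *: w) 0] =
      g.@[x 0] + t * (\sum_(j < n) gradient g x 0 j * v 0 j) + t ^+ 2 * p.[t].
Proof.
pose dir g := \sum_(j < n) gradient g x 0 j * v 0 j.
have dirE h : dir h = \sum_(j < n) (h^`M(j)).@[x 0] * v 0 j.
  by apply: eq_bigr => j _; rewrite mxE.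
elim/mpoly_ind_ring: g => [c|i|g h [p gE] [q hE]|g h [p gE] [q hE]].
- exists 0 => t; rewrite -/(dir _) dirE big1 => [|j _].
    by rewrite !mevalC hornerC !mulr0 !addr0.
  by rewrite mderivC meval0 mul0r.
- exists (w 0 i)%:P => t; rewrite -/(dir _) dirE (bigD1 i) //= big1 => [|j jNi].
    rewrite !mevalXU hornerC !mxE addr0 mderivX mnm1E eqxx.
    by rewrite -{1}[U_(i)%MM]add0m addmK mpolyX0 scale1r meval1 mul1r.
  by rewrite mderivX mnm1E eq_sym (negPf jNi) scale0r meval0 mul0r.
- exists (p + q) => t; rewrite mevalD gE hE -!/(dir _) !dirE hornerD mevalD.
  under [in RHS]eq_bigr do rewrite mderivD mevalD mulrDl.
  by rewrite big_split /=; ring.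
- exists ((dir g * dir h)%:P + g.@[x 0] *: q + h.@[x 0] *: p
           + (dir g *: 'X * q) + (dir h *: 'X * p) + 'X^2 * p * q) => t.
  rewrite mevalM gE hE -!/(dir _) mevalM.
  have -> : dir (g * h) = dir g * h.@[x 0] + g.@[x 0] * dir h.
    rewrite !dirE mulr_suml mulr_sumr -big_split /=; apply: eq_bigr => j _.
    by rewrite mderivM mevalD !mevalM; ring.
  by rewrite !hornerE; ring.
Qed.

(** Parabolas are used in place of lines because a quadric contains, in each of
    its tangent directions, a parabola but in general no line; this describes
    the tangent space without any Nullstellensatz. *)
Lemma parabola_tangent (K : numFieldType) n (g : {mpoly K[n]})
    (x v w : 'rV[K]_n) :
    (forall t, g.@[(x + t *: v + t ^+ 2 *: w) 0] = 0) ->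
  \sum_(j < n) gradient g x 0 j * v 0 j = 0.
Proof.
move=> g0; have [p gE] := meval_parabola g x v w.
set c := (X in X = 0) in gE *.
have : (g.@[x 0])%:P + c *: 'X + 'X^2 * p = 0.
  by apply: poly_identically0 => t; rewrite !hornerE -[RHS](g0 t) gE mulrC.
move/(congr1 (fun q : {poly K} => q`_1)).
by rewrite !coefD coefC coefZ coefX coefXnM coef0 /= mulr1 addr0 add0r.
Qed.

Lemma meval_point0 (K : comNzRingType) n (p : {mpoly K[n]}) :
  p.@[(0 : 'rV[K]_n) 0] = p@_0%MM.
Proof.
elim/mpoly_ind_ring: p => [c|i|p q IHp IHq|p q IHp IHq].
- by rewrite mevalC mcoeffC eqxx mulr1.
- by rewrite mevalXU mxE mcoeffX -mdeg_eq0 mdeg1.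
- by rewrite mevalD mcoeffD IHp IHq.
- by rewrite mevalM IHp IHq rmorphM.
Qed.

(** If p vanishes everywhere then so do its directional derivatives, hence all
    its iterated partial derivatives; at the origin these are, up to nonzero
    factorials, the coefficients of p. *)
Lemma mpoly_nonvanishing (K : numFieldType) n (p : {mpoly K[n]}) :
  p != 0 -> exists x : 'rV[K]_n, p.@[x 0] != 0.
Proof.
move=> pN0; apply: contrapT => /forallNP p0.
suff : p = 0 by move/eqP: pN0.
have {pN0}p0 (x : 'rV[K]_n) : p.@[x 0] = 0 by have /negP/negbNE/eqP := p0 x.
have dp0 (q : {mpoly K[n]}) i : (forall x : 'rV[K]_n, q.@[x 0] = 0) ->
    forall x : 'rV[K]_n, (q^`M(i)).@[x 0] = 0.
  move=> q0 x.
  have := @parabola_tangent _ _ q x (delta_mx 0 i) 0 (fun t => q0 _).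
  rewrite (bigD1 i) //= big1 => [|j jNi]; rewrite !mxE !eqxx ?mulr1 ?addr0 //.
  by rewrite (negPf jNi) mulr0.
apply/mpolyP => m; rewrite mcoeff0.
have : (p^`M[m])@_0%MM = 0.
  rewrite -meval_point0 mderivm_foldr.
  elim: (flatten _) (0 : 'rV[K]_n) => [|i s IHs] x /=; first exact: p0.
  exact: dp0.
rewrite mcoeff_mderivm addm0 => /eqP; rewrite mulrn_eq0 => /orP[|/eqP//].
rewrite -leqn0 leqNgt prodn_gt0 // => i; by rewrite ffactnn fact_gt0.
Qed.

(** * Quadratic forms as polynomials *)

Definition quadratic_mpoly (K : comNzRingType) n (A : 'M[K]_n) : {mpoly K[n]} :=
  \sum_i \sum_j (A i j) *: ('X_i * 'X_j).

Lemma bilinE (K : fieldType) n (A : 'M[K]_n) (x y : 'rV[K]_n) :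
  bilin A x y = \sum_i \sum_j A i j * (x 0 i * y 0 j).
Proof.
rewrite /bilin mxE exchange_big /=; apply: eq_bigr => j _; rewrite !mxE mulr_suml.
by apply: eq_bigr => i _; ring.
Qed.

Lemma meval_quadratic (K : fieldType) n (A : 'M[K]_n) (x : 'rV[K]_n) :
  (quadratic_mpoly A).@[x 0] = bilin A x x.
Proof.
rewrite bilinE raddf_sum; apply: eq_bigr => i _.
rewrite raddf_sum; apply: eq_bigr => j _.
by rewrite /= mevalZ mevalM !mevalXU.
Qed.

(** Symmetric matrices represent a space of polynomials, so the quadratic
    monomials suffice; X_i X_j comes from half of E_ij + E_ji. *)
Lemma homog2_quadratic (K : numFieldType) n (F : {mpoly K[n]}) :
  F \is 2.-homog -> exists2 A : 'M[K]_n, A^T = A & F = quadratic_mpoly A.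
Proof.
pose P F := exists2 A : 'M[K]_n, A^T = A & F = quadratic_mpoly A.
have P0 : P 0.
  exists 0; first exact: trmx0.
  by rewrite /quadratic_mpoly big1 // => i _; rewrite big1 // => j _;
     rewrite mxE scale0r.
have PD p q : P p -> P q -> P (p + q).
  move=> [A As ->] [B Bs ->]; exists (A + B); first by rewrite linearD /= As Bs.
  rewrite /quadratic_mpoly -big_split; apply: eq_bigr => i _.
  rewrite -big_split; apply: eq_bigr => j _.
  by rewrite mxE scalerDl.
have PZ c p : P p -> P (c *: p).
  move=> [A As ->]; exists (c *: A); first by rewrite linearZ /= As.
  rewrite /quadratic_mpoly scaler_sumr; apply: eq_bigr => i _.
  rewrite scaler_sumr; apply: eq_bigr => j _.
  by rewrite mxE scalerA.
have PE i j : P ('X_i * 'X_j).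
  pose E i j : 'M[K]_n := delta_mx i j.
  have qE k l : quadratic_mpoly (E k l) = 'X_k * 'X_l.
    rewrite /quadratic_mpoly (bigD1 k) //= (bigD1 l) //= !big1; first last.
    - by move=> b bNl; rewrite mxE (negPf bNl) andbF scale0r.
    - move=> a aNk; rewrite big1 // => b _.
      by rewrite mxE (negPf aNk) scale0r.
    by rewrite mxE !eqxx scale1r !addr0.
  exists (2^-1 *: (E i j + E j i)).
    by rewrite linearZ linearD /= !trmx_delta addrC.
  have -> : quadratic_mpoly (2^-1 *: (E i j + E j i))
          = 2^-1 *: (quadratic_mpoly (E i j) + quadratic_mpoly (E j i)).
    rewrite /quadratic_mpoly -big_split scaler_sumr; apply: eq_bigr => a _ /=.
    rewrite -big_split scaler_sumr; apply: eq_bigr => b _ /=.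
    by rewrite -scalerDl scalerA mxE mxE.
  rewrite !qE ['X_j * _]mulrC -mulr2n -scaler_nat scalerA mulVf ?scale1r //.
  by rewrite pnatr_eq0.
move=> /dhomogP F2; rewrite -/(P F).
suff PX m : m \in msupp F -> P 'X_[m].
  by rewrite [F]mpolyE big_seq; apply: (big_ind P) => // m mF; exact/PZ/PX.
move=> /F2 /= m2.
have [i mi] : exists i, (0 < m i)%N.
  apply/existsP; apply: contra_eqT m2 => /existsPn m0.
  suff -> : m = 0%MM by rewrite mdeg0.
  by apply/mnmP => i; rewrite mnm0E; apply/eqP; rewrite eqn0Ngt m0.
(* A monomial of degree 2 is a variable times a monomial of degree 1. *)
have mE : m = (m - U_(i) + U_(i))%MM.
  by rewrite submK //; apply/mnm_lepP => j; rewrite mnm1E; case: eqP => // <-.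
have /mdeg1P[j /eqP mj] : mdeg (m - U_(i))%MM == 1%N.
  by move/(congr1 mdeg): mE; rewrite mdegD mdeg1 m2 addn1 => -[<-].
by rewrite mE mj mpolyXD.
Qed.

Lemma quadratic_gradient (K : fieldType) n (A : 'M[K]_n) (x : 'rV[K]_n) :
  A^T = A -> gradient (quadratic_mpoly A) x = 2 *: (x *m A).
Proof.
move=> As; apply/rowP => k; rewrite !mxE.
have dX (i : 'I_n) : ('X_i : {mpoly K[n]})^`M(k) = (i == k)%:R%:MP.
  rewrite mderivX mnm1E; case: eqP => [->|_].
    by rewrite -{1}[U_(k)%MM]add0m addmK mpolyX0 scale1r.
  by rewrite scale0r.
rewrite /quadratic_mpoly (raddf_sum (mderiv k)) (raddf_sum (meval _)) mulr_sumr.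
under eq_bigr => i _.
  rewrite /= (raddf_sum (mderiv k)) (raddf_sum (meval _)) /=.
  under eq_bigr => j _ do
    rewrite mderivZ mevalZ mderivM !dX mevalD !mevalM !mevalXU !mevalC mulrDr.
  rewrite big_split /=; over.
rewrite big_split /= (bigD1 k) //= [X in _ + X + _]big1 => [|i iNk]; last first.
  by rewrite big1 // => j _; rewrite (negPf iNk) mul0r mulr0.
under [X in _ + X = _]eq_bigr => i _.
  rewrite (bigD1 k) //= big1 => [|j jNk]; last first.
    by rewrite (negPf jNk) !mulr0.
  rewrite eqxx mulr1 addr0; over.
rewrite addr0 -big_split /=; apply: eq_bigr => i _.
by rewrite eqxx mulr1n -{1}As mxE; ring.
Qed.

(** * The cone over a smooth quadric *)

(** Lagrange multiplier principle for one constraint. *)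
Lemma functional_multiple (K : fieldType) n (p q : 'rV[K]_n) :
    (forall v : 'rV[K]_n, \sum_j q 0 j * v 0 j = 0 -> \sum_j p 0 j * v 0 j = 0) ->
  exists l, p = l *: q.
Proof.
move=> qp; have dotE (r : 'rV[K]_n) k :
    \sum_j r 0 j * (delta_mx 0 k : 'rV[K]_n) 0 j = r 0 k.
  rewrite (bigD1 k) //= big1 => [|j jNk]; rewrite [delta_mx _ _ _ _]mxE eqxx /=.
    by rewrite eqxx mulr1 addr0.
  by rewrite (negPf jNk) mulr0.
have [q0|/rV0Pn[k qk]] := eqVneq q 0.
  exists 0; rewrite scale0r; apply/rowP => j; rewrite [RHS]mxE -dotE qp //.
  by rewrite dotE q0 mxE.
exists (p 0 k / q 0 k); apply/rowP => j; rewrite [RHS]mxE.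
have dot2 (r : 'rV[K]_n) :
    \sum_i r 0 i * (q 0 k *: delta_mx 0 j - q 0 j *: delta_mx 0 k : 'rV[K]_n) 0 i
    = q 0 k * r 0 j - q 0 j * r 0 k.
  rewrite -!(dotE r) !mulr_sumr -sumrB; apply: eq_bigr => i _.
  by rewrite !mxE; ring.
have := qp (q 0 k *: delta_mx 0 j - q 0 j *: delta_mx 0 k).
rewrite !dot2 mulrC subrr => /(_ erefl)/eqP; rewrite subr_eq0 => /eqP h.
by apply: (mulfI qk); rewrite h; field.
Qed.

Section QuadricCone.
Variables (K : numFieldType) (n : nat) (A : 'M[K]_n).
Hypotheses (A_sym : A^T = A) (A_unit : A \in unitmx).
Implicit Types (x y v w : 'rV[K]_n) (g : {mpoly K[n]}).

Local Notation Z := (zero_locus (quadratic_mpoly A)).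
Local Notation B := (bilin A).

Lemma mem_cone x : Z x <-> B x x = 0.
Proof. by rewrite /zero_locus /= meval_quadratic. Qed.

Lemma bilin_dot x v : B x v = \sum_j (x *m A) 0 j * v 0 j.
Proof. by rewrite /bilin mxE; apply: eq_bigr => j _; rewrite [_^T _ _]mxE. Qed.

Let BC x y : B x y = B y x.
Proof. exact: bilinC. Qed.

(** The hyperbolic plane spanned by x: any w pairing to 1 with x becomes
    isotropic after subtracting a multiple of x. *)
Lemma isotropic_partner x : x != 0 -> B x x = 0 ->
  exists2 w, B x w = 1 & B w w = 0.
Proof.
move=> xN0 xx.
have /rV0Pn[j xAj] : x *m A != 0.
  by apply: contra xN0 => /eqP xA; rewrite -(mulmxK A_unit x) xA mul0mx.
pose w := ((x *m A) 0 j)^-1 *: delta_mx 0 j : 'rV[K]_n.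
have xw : B x w = 1.
  by rewrite bilinZr /bilin trmx_delta -colE [col _ _ _ _]mxE mulVf.
move: w xw => w xw {j xAj}.
exists (w - (B w w / 2) *: x).
  by rewrite bilinBr bilinZr xx mulr0 subr0.
rewrite bilinBr !bilinBl !bilinZr !bilinZl xx xw (BC w x) xw.
by field; rewrite ?pnatr_eq0.
Qed.

(** Stereographic projection of the quadric from w, restricted to the line
    through x with direction v: since v is orthogonal to w, the quadratic
    correction along w makes the parametrization polynomial. *)
Lemma tangent_parabola x w v t : B x x = 0 -> B x w = 1 -> B w w = 0 ->
  B x v = 0 -> B v w = 0 -> Z (x + t *: v + t ^+ 2 *: (- (B v v / 2) *: w)).
Proof.
move=> xx xw ww xv vw; apply/mem_cone.
rewrite !(bilinDr, bilinDl, bilinZr, bilinZl) xx xw ww xv vw.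
rewrite (BC w x) (BC w v) (BC v x) xw vw xv; by field; rewrite ?pnatr_eq0.
Qed.

Lemma gradient_ray g x y : vanishing_ideal Z g ->
  (forall t, Z (x + t *: y)) -> \sum_j gradient g x 0 j * y 0 j = 0.
Proof.
move=> gZ xyZ; apply: (@parabola_tangent _ _ _ x y 0) => t.
by rewrite scaler0 addr0; apply/gZ/xyZ.
Qed.

(** The inclusion of the hyperplane orthogonal to x in the tangent space is the
    point where the whole vanishing ideal, and not only the equation of the
    quadric, has to be controlled.  A vector v orthogonal to x is decomposed as
    v' + B(v,w) x, where v' is tangent to a parabola and x to the ray of x. *)
Lemma tangent_space_cone x v : x != 0 -> Z x -> tangent_space Z x v <-> B x v = 0.
Proof.
move=> xN0 xZ; have /mem_cone xx := xZ; split.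
  move=> /(_ (quadratic_mpoly A) (fun _ => id)).
  rewrite quadratic_gradient // => h.
  apply: (@mulfI _ (2 : K)); rewrite ?pnatr_eq0 // mulr0 -h bilin_dot mulr_sumr.
  by apply: eq_bigr => j _; rewrite [in RHS]mxE mulrA.
move=> xv g gZ.
have [w xw ww] := isotropic_partner xN0 xx.
pose v' := v - B v w *: x.
have v'0 : \sum_j gradient g x 0 j * v' 0 j = 0.
  apply: (@parabola_tangent _ _ _ x v' (- (B v' v' / 2) *: w)) => t.
  apply: gZ; apply: tangent_parabola => //.
    by rewrite bilinBr bilinZr xx xv mulr0 subr0.
  by rewrite bilinBl bilinZl xw mulr1 subrr.
have x0 : \sum_j gradient g x 0 j * x 0 j = 0.
  apply: gradient_ray => // t; apply/mem_cone.
  by rewrite !(bilinDr, bilinDl, bilinZr, bilinZl) xx !(mulr0, addr0).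
transitivity (\sum_j gradient g x 0 j * v' 0 j
                + B v w * \sum_j gradient g x 0 j * x 0 j); last first.
  by rewrite v'0 x0 mulr0 addr0.
rewrite mulr_sumr -big_split; apply: eq_bigr => j _ /=.
have -> : v' 0 j = v 0 j - B v w * x 0 j by rewrite !mxE.
by ring.
Qed.

(** The cone spans the whole space, so its vertex is singular: the gradient at 0
    of a polynomial vanishing on the cone kills every ray of the cone. *)
Lemma cone_gradient0 g x : x != 0 -> Z x -> vanishing_ideal Z g ->
  gradient g 0 = 0.
Proof.
move=> xN0 /mem_cone xx gZ.
have [w xw ww] := isotropic_partner xN0 xx.
pose d v := \sum_j gradient g 0 0 j * v 0 j.
have dD u v : d (u + v) = d u + d v.
  by rewrite /d -big_split; apply: eq_bigr => j _ /=; rewrite [(u + v) 0 j]mxE mulrDr.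
have dZ c v : d (c *: v) = c * d v.
  by rewrite /d mulr_sumr; apply: eq_bigr => j _ /=; rewrite [(c *: v) 0 j]mxE mulrCA.
have dZ0 y : B y y = 0 -> d y = 0.
  move=> yy; apply: gradient_ray => // t; apply/mem_cone.
  by rewrite add0r bilinZr bilinZl yy !mulr0.
have dx := dZ0 x xx; have dw := dZ0 w ww.
have d0 v : d v = 0.
  pose v' := v - B v w *: x - B v x *: w.
  have v'x : B x v' = 0.
    by rewrite !(bilinBr, bilinZr) xx xw (BC x v); ring.
  have v'w : B v' w = 0.
    by rewrite !(bilinBl, bilinZl) xw ww; ring.
  have vE : v = v' + B v x *: w + B v w *: x by rewrite /v' !subrK.
  move: v' v'x v'w vE => v' v'x v'w ->.
  (* At t = 1 the parabola gives a point x + v' + c w of the cone, so v' lies in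
     the span of the cone, like x and w. *)
  have /mem_cone/dZ0 := tangent_parabola 1 xx xw ww v'x v'w.
  by rewrite !dD !dZ dx dw !mulr0 !addr0 add0r mul1r.
apply/rowP => j; rewrite [RHS]mxE -(d0 (delta_mx 0 j)) /d (bigD1 j) //=.
rewrite big1 => [|k kNj]; rewrite [delta_mx _ _ _ _]mxE eqxx /=.
  by rewrite eqxx mulr1 addr0.
by rewrite (negPf kNj) mulr0.
Qed.

(** The Jacobian rank is 1 away from the vertex, all gradients being multiples
    of x A, and 0 at the vertex.  The existence of a nonzero point is what
    makes 1 the maximal rank. *)
Lemma smooth_locus_cone x : (exists2 y, y != 0 & Z y) ->
  smooth_locus Z x <-> x != 0 /\ Z x.
Proof.
move=> [y0 y0N0 y0Z].
have rank0 y : jacobian_rank_ge Z y 0.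
  exists (fun _ => 0) => [[]//|]; rewrite /row_free; apply/eqP.
  by apply/eqP; rewrite -leqn0 rank_leq_row.
have rank1 y : y != 0 -> Z y -> jacobian_rank_ge Z y 1.
  move=> yN0 yZ; exists (fun _ => quadratic_mpoly A) => [_ z //|].
  rewrite /row_free (_ : \matrix_(i < 1) _ = gradient (quadratic_mpoly A) y); last first.
    by apply/rowP => j; rewrite !mxE.
  rewrite rank_rV quadratic_gradient // scaler_eq0 pnatr_eq0 /=.
  rewrite (_ : y *m A == 0 = false) //; apply: contraNF yN0 => /eqP yA.
  by rewrite -(mulmxK A_unit y) yA mul0mx.
have rank_le1 y k : y != 0 -> Z y -> jacobian_rank_ge Z y k -> (k <= 1)%N.
  move=> yN0 yZ [G GZ /eqP G_free].
  have /choice[c cE] i : exists c, gradient (G i) y = c *: (y *m A).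
    apply: functional_multiple => v; rewrite -bilin_dot => yv.
    by move/(tangent_space_cone _ yN0 yZ): yv => /(_ (G i) (GZ i)).
  rewrite -G_free (_ : \matrix_i _ = (\col_i c i) *m (y *m A)).
    by rewrite (leq_trans (mxrankM_maxr _ _)) // rank_leq_row.
  by apply/row_matrixP => i; rewrite rowK cE row_mul; apply/rowP => j;
     rewrite !mxE big_ord1 !mxE.
have rank_at0 k : jacobian_rank_ge Z 0 k -> k = 0%N.
  move=> [G GZ /eqP <-]; apply/eqP; rewrite mxrank_eq0; apply/eqP/row_matrixP => i.
  by rewrite rowK row0; apply: cone_gradient0 y0N0 y0Z (GZ i).
split=> [[xZ xmax]|[xN0 xZ]]; split=> //.
  apply/eqP => x0; have := xmax _ _ y0Z (rank1 _ y0N0 y0Z).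
  by rewrite x0 => /rank_at0.
move=> y [|k] yZ yk; first exact: rank0.
have [y_eq0|yN0] := eqVneq y 0; first by move: yk; rewrite y_eq0 => /rank_at0.
by case: k yk => [|k] /(rank_le1 _ _ yN0 yZ) // _; apply: rank1.
Qed.

End QuadricCone.

(** Stationarity with Lagrange multiplier l. *)
Lemma ED_critical_points_quadric (R : realType) n (A : 'M[R[i]]_n) (Q : 'M[R]_n)
    (u x : 'rV[R[i]]_n) : A^T = A -> A \in unitmx ->
    (exists2 y : 'rV[R[i]]_n, y != 0 & bilin A y y = 0) ->
  ED_critical_points Q (zero_locus (quadratic_mpoly A)) u x <->
  [/\ x != 0, bilin A x x = 0 &
      exists l, (u - x) *m complexify_form Q = l *: (x *m A)].
Proof.
move=> As Au [y yN0 yy].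
have sm := @smooth_locus_cone _ _ A As Au x.
have {}sm := sm (ex_intro2 _ _ y yN0 (proj2 (mem_cone _ _) yy)).
rewrite /ED_critical_points /=; split.
  move=> [/sm[xN0 xZ] crit]; split=> //; first exact/mem_cone.
  apply: functional_multiple => v; rewrite -!bilin_dot => xv.
  by apply/crit/(tangent_space_cone As Au).
move=> [xN0 xx [l ul]]; have xZ := proj2 (mem_cone _ _) xx.
split; first exact/sm.
move=> v /(tangent_space_cone As Au _ xN0 xZ) xv.
by rewrite /bilin ul -scalemxAl mxE -/(bilin A x v) xv mulr0.
Qed.

(** * Simultaneous diagonalization of two real quadratic forms *)

(** A complex eigenvector a + i b of A Q^-1 exists because R[i] is algebraically
    closed.  Its eigenvalue p + i q is real: expanding a A b^T = b A a^T gives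
    q (a Q a^T + b Q b^T) = 0.  Hence a and b are themselves eigenvectors,
    unless they vanish. *)
Lemma pencil_real_eigenvector (R : rcfType) n (A Q : 'M[R]_n.+1) :
    A^T = A -> Q^T = Q -> (forall x : 'rV[R]_n.+1, x != 0 -> 0 < bilin Q x x) ->
  exists2 x : 'rV[R]_n.+1, x != 0 & exists l, x *m A = l *: (x *m Q).
Proof.
move=> As Qs Qpos.
have Qge0 x : 0 <= bilin Q x x.
  have [->|/Qpos/ltW//] := eqVneq x 0.
  by rewrite /bilin !mul0mx mxE.
have Qu : Q \in unitmx.
  rewrite -row_free_unit -kermx_eq0; apply/rowV0P => x /sub_kermxP xQ0.
  apply/eqP; apply: contraT => /Qpos.
  by rewrite /bilin xQ0 mul0mx mxE ltxx.
pose f := real_complex R.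
have [z /eqP z_root] : exists z, root (char_poly (map_mx f (A *m invmx Q))) z.
  by apply/closed_rootP; rewrite size_char_poly.
have /eigenvalueP[v vE vN0] :
    eigenvalue (map_mx f (A *m invmx Q)) z.
  by rewrite eigenvalue_root_char; apply/eqP.
have {}vE : v *m map_mx f A = z *: (v *m map_mx f Q).
  rewrite -[A in LHS](mulmxKV Qu) map_mxM mulmxA vE.
  by rewrite scalemxAl.
pose a : 'rV[R]_n.+1 := map_mx (@complex.Re R) v.
pose b : 'rV[R]_n.+1 := map_mx (@complex.Im R) v.
have ReM (s t : R[i]) : complex.Re (s * t) =
    complex.Re s * complex.Re t - complex.Im s * complex.Im t.
  by case: s t => ? ? [? ?].
have ImM (s t : R[i]) : complex.Im (s * t) =
    complex.Re s * complex.Im t + complex.Im s * complex.Re t.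
  by case: s t => ? ? [? ?].
pose p := complex.Re z; pose q := complex.Im z.
have ReIm_mul (M : 'M[R]_n.+1) :
    (map_mx (@complex.Re R) (v *m map_mx f M) = a *m M) *
    (map_mx (@complex.Im R) (v *m map_mx f M) = b *m M).
  by split; apply/rowP => j; rewrite !mxE raddf_sum; apply: eq_bigr => i _;
    rewrite !mxE; case: (v 0 i) => r s /=; rewrite !mulr0 ?subr0 ?add0r.
have aE : a *m A = p *: (a *m Q) - q *: (b *m Q).
  rewrite -!(ReIm_mul A) vE; apply/rowP => j.
  by rewrite -!ReIm_mul !mxE ReM.
have bE : b *m A = p *: (b *m Q) + q *: (a *m Q).
  rewrite -!(ReIm_mul A) vE; apply/rowP => j.
  by rewrite -!ReIm_mul !mxE ImM.
have abN0 : (a != 0) || (b != 0).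
  rewrite -negb_and; apply: contra vN0 => /andP[/eqP a0 /eqP b0].
  apply/eqP/rowP => j; move/rowP/(_ j): a0; move/rowP/(_ j): b0.
  by rewrite !mxE; case: (v 0 j) => r s /= -> ->.
have q0 : q = 0.
  have : q * (bilin Q a a + bilin Q b b) = 0.
    have Aab : bilin A a b = p * bilin Q a b - q * bilin Q b b.
      rewrite {1}/bilin aE mulmxBl -!scalemxAl.
      by rewrite [LHS]mxE [X in _ + X]mxE; congr (_ - _); rewrite mxE.
    have Aba : bilin A b a = p * bilin Q b a + q * bilin Q a a.
      rewrite {1}/bilin bE mulmxDl -!scalemxAl.
      by rewrite [LHS]mxE; congr (_ + _); rewrite mxE.
    have := bilinC a b As; rewrite Aab Aba (bilinC b a Qs) => /eqP.
    rewrite -subr_eq0 => /eqP h; apply: oppr_inj; rewrite oppr0 -h; ring.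
  move/eqP; rewrite mulf_eq0 => /orP[/eqP//|].
  rewrite paddr_eq0 // => /andP[/eqP Qa /eqP Qb].
  by case/orP: abN0 => /Qpos; rewrite ?Qa ?Qb ltxx.
case/orP: abN0 => [aN0|bN0].
  by exists a => //; exists p; rewrite aE q0 scale0r subr0.
by exists b => //; exists p; rewrite bE q0 scale0r addr0.
Qed.

Lemma row_free_complement (K : fieldType) n (y : 'cV[K]_n.+1) :
  y != 0 -> exists2 B : 'M[K]_(n, n.+1), row_free B & B *m y = 0.
Proof.
move=> yN0.
have rk : \rank (kermx y) = n.
  by rewrite mxrank_ker -mxrank_tr rank_rV trmx_eq0 yN0 subn1.
exists (castmx (rk, erefl) (row_base (kermx y))).
  by rewrite row_free_castmx row_base_free.
apply/row_matrixP => i; rewrite row_mul row0; apply/sub_kermxP.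
by rewrite -(eq_row_base (kermx y)) -(eqmx_cast (row_base (kermx y)) (rk, erefl)) row_sub.
Qed.

(** Induction on the dimension: an eigenvector x of the pencil splits off, since
    the Q-orthogonal of x is also A-orthogonal to x.  Starting from x scaled to
    Q-norm 1, the rows of B span that orthogonal. *)
Lemma simultaneous_diagonalization (R : rcfType) n (A Q : 'M[R]_n) :
    A^T = A -> Q^T = Q -> (forall x : 'rV[R]_n, x != 0 -> 0 < bilin Q x x) ->
  exists2 M : 'M[R]_n, M *m Q *m M^T = 1%:M &
    exists d : 'rV[R]_n, M *m A *m M^T = diag_mx d.
Proof.
elim: n => [|n IHn] in A Q * => As Qs Qpos.
  by exists 1%:M; [apply/matrixP => -[] | exists 0; apply/matrixP => -[]].
have [x xN0 [l xA]] := pencil_real_eigenvector As Qs Qpos.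
have Qx_gt0 := Qpos x xN0.
pose y : 'cV[R]_n.+1 := Q *m x^T.
have xy : x *m y = (bilin Q x x)%:M.
  by rewrite /y mulmxA [LHS]mx11_scalar.
have yN0 : y != 0.
  apply: contraTneq Qx_gt0 => y0.
  by rewrite /bilin -mulmxA -/y y0 mulmx0 mxE ltxx.
have [B B_free By] := row_free_complement yN0.
have [|||M MQ [d MA]] := IHn (B *m A *m B^T) (B *m Q *m B^T).
- by rewrite !trmx_mul trmxK As mulmxA.
- by rewrite !trmx_mul trmxK Qs mulmxA.
- move=> z zN0; have -> : bilin (B *m Q *m B^T) z z = bilin Q (z *m B) (z *m B).
    by rewrite /bilin trmx_mul !mulmxA.
  apply: Qpos; apply: contra zN0 => /eqP zB; apply/eqP.
  by apply: (row_free_inj B_free); rewrite zB mul0mx.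
pose c := (Num.sqrt (bilin Q x x))^-1.
have cc : c * c * bilin Q x x = 1.
  rewrite -invfM -expr2 sqr_sqrtr ?ltW // mulVf //; exact: lt0r_neq0.
have yB : x *m Q *m B^T = 0.
  by apply: trmx_inj; rewrite !trmx_mul trmxK Qs By trmx0.
pose P : 'M[R]_(1 + n, n.+1) := col_mx (c *: x) (M *m B).
have blockE (S : 'M[R]_n.+1) m : S^T = S -> x *m S = m *: (x *m Q) ->
    P *m S *m P^T = block_mx m%:M 0 0 (M *m (B *m S *m B^T) *m M^T).
  move=> Ss xS; rewrite /P tr_col_mx mul_col_mx mul_col_row.
  have xSB : x *m S *m B^T = 0 by rewrite xS -scalemxAl yB scaler0.
  have BSx : B *m S *m x^T = 0.
    by apply: trmx_inj; rewrite !trmx_mul trmxK Ss mulmxA xSB trmx0.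
  congr block_mx.
  - rewrite linearZ /= -!scalemxAl -scalemxAr xS -scalemxAl.
    rewrite [x *m Q *m x^T]mx11_scalar -/(bilin Q x x) !scale_scalar_mx.
    by congr (_%:M); rewrite -[RHS]mulr1 -cc; ring.
  - by rewrite trmx_mul mulmxA -!scalemxAl xSB mul0mx scaler0.
  - rewrite linearZ /= -scalemxAr -[M *m B *m S]mulmxA -[M *m _ *m _]mulmxA BSx.
    by rewrite mulmx0 scaler0.
  - by rewrite trmx_mul !mulmxA.
exists P.
  by rewrite (blockE Q 1) ?scale1r // MQ -scalar_mx_block.
exists (row_mx l%:M d).
have dl : diag_mx (l%:M : 'rV[R]_1) = l%:M.
  by apply/matrixP => i j; rewrite !mxE !ord1 eqxx.
have := diag_mx_row (l%:M : 'rV[R]_1) d; rewrite dl => dE.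
by rewrite (blockE A l) // MA; exact: esym dE.
Qed.

(** * The secular polynomial *)

(** The Sylvester matrix only depends on the coefficients and on the two
    degrees, so resultants specialize well as long as the degrees do not drop. *)
Lemma resultant_map_poly (A B : nzRingType) (f : {rmorphism A -> B})
    (p q : {poly A}) : size (map_poly f p) = size p -> size (map_poly f q) = size q ->
  resultant (map_poly f p) (map_poly f q) = f (resultant p q).
Proof.
move=> sp sq; rewrite /resultant -det_map_mx /Sylvester_mx sp sq map_col_mx.
by congr (\det (col_mx _ _)); apply/esym/map_lin1_mx => v;
  rewrite /= map_poly_rV rmorphM /= map_rVpoly.
Qed.

Lemma notin_seq_exists (K : numFieldType) (s : seq K) : exists c, c \notin s.
Proof.
pose t := [seq (i%:R : K) | i <- iota 0 (size s).+1].
have t_uniq : uniq t.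
  by rewrite map_inj_uniq ?iota_uniq //; apply: mulrIn; rewrite oner_eq0.
have /allPn[c _ cNs] : ~~ all (mem s) t.
  apply/negP => /allP /(uniq_leq_size t_uniq).
  by rewrite size_map size_iota ltnn.
by exists c.
Qed.

(** Bertini's theorem for a pencil without base points.  A double root z of
    p + c q is a root of the Wronskian W = p' q - p q', and then q(z) != 0 and
    c = - p(z) / q(z).  W is nonzero, otherwise q would divide q'; so only
    finitely many c are excluded. *)
Lemma pencil_separable (K : numClosedFieldType) (p q : {poly K}) :
    coprimep p q -> (1 < size q)%N ->
  exists bad : seq K, forall c, c \notin bad -> separable_poly (p + c *: q).
Proof.
move=> pq q1; pose W := p^`() * q - p * q^`().
have qN0 : q != 0 by rewrite -size_poly_gt0 (leq_trans _ q1).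
have WN0 : W != 0.
  apply: contraTneq q1 => /eqP; rewrite subr_eq0 => /eqP Wpq.
  have : q %| q^`() by rewrite -(Gauss_dvdpr _ (q := p)) 1?coprimep_sym // -Wpq dvdp_mull.
  rewrite -leqNgt => q_dvd.
  have q'0 : q^`() = 0.
    apply/eqP; apply: contraTT q_dvd => q'N0.
    by rewrite gtNdvdp // lt_size_deriv.
  rewrite leqNgt; apply/negP => q1'; move: qN0; rewrite -lead_coef_eq0 lead_coefE.
  case: (size q) q1' => [|[|k]] // _ /=; move/polyP/(_ k): q'0.
  by rewrite coef_deriv coef0 => /eqP; rewrite mulrn_eq0 /= => ->.
have [rs WE] := closed_field_poly_normal W.
exists [seq - (p.[z] / q.[z]) | z <- rs] => c; apply: contraR.
rewrite unlock => /Pdiv.ClosedField.coprimepP h.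
have [z fz f'z] : exists2 z, root (p + c *: q) z & (p + c *: q)^`().[z] = 0.
  apply: contrapT => h'; apply: h => z fz; apply/eqP => f'z; apply: h'; by exists z.
have pz : p.[z] = - (c * q.[z]).
  by apply/eqP; rewrite -addr_eq0; move: fz; rewrite rootE !hornerE.
have p'z : p^`().[z] = - (c * q^`().[z]).
  by apply/eqP; rewrite -addr_eq0; move: f'z; rewrite derivD derivZ !hornerE => ->.
have qz : q.[z] != 0.
  apply: contraTneq pq => qz; apply/Pdiv.ClosedField.coprimepP => /(_ z).
  by rewrite rootE pz qz mulr0 oppr0 eqxx => /(_ isT)/eqP.
apply/mapP; exists z; last by rewrite pz; field.
rewrite -root_prod_XsubC -(rootZ _ _ (_ : lead_coef W != 0)) ?lead_coef_eq0 // -WE.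
by rewrite rootE !hornerE pz p'z; apply/eqP; ring.
Qed.

Section SecularPolynomial.
Variables (K : numClosedFieldType) (n : nat) (r : 'I_n -> K).
Hypothesis r_neq0 : forall i, r i != 0.
Implicit Types (w : 'rV[K]_n) (z : K).

Local Notation S := (undup (codom r)).
Local Notation d := (2 * (size S).-1)%N.

(** The nodes are the distinct values of r; the node z itself is left out, so
    that the squares of these polynomials are the numerators of the partial
    fractions 1 / (X - z)^2 over the common denominator. *)
Definition node_poly z : {poly K} := \prod_(s <- rem z S) ('X - s%:P).

Lemma mem_nodes i : r i \in S.
Proof. by rewrite mem_undup codom_f. Qed.

Lemma root_node z x : root (node_poly z) x = (x != z) && (x \in S).
Proof. by rewrite root_prod_XsubC mem_rem_uniq ?undup_uniq. Qed.

Lemma node_sqr_monic z : node_poly z ^+ 2 \is monic.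
Proof. by rewrite monic_exp // monic_prod_XsubC. Qed.

Lemma size_node_sqr i : size (node_poly (r i) ^+ 2) = d.+1.
Proof.
rewrite (@polySpred _ (_ ^+ 2)) ?monic_neq0 ?node_sqr_monic //.
by rewrite size_exp size_prod_XsubC size_rem ?mem_nodes // mulnC.
Qed.

Lemma coef_node_sqr i : (node_poly (r i) ^+ 2)`_d = 1.
Proof. by rewrite -(monicP (node_sqr_monic (r i))) lead_coefE size_node_sqr. Qed.

(** The numerator of the rational function \sum_i r_i w_i^2 / (X - r_i)^2. *)
Definition secular_poly w : {poly K} :=
  \sum_i (r i * w 0 i ^+ 2) *: node_poly (r i) ^+ 2.

Lemma size_secular w : (size (secular_poly w) <= d.+1)%N.
Proof.
apply: (leq_trans (size_sum _ _ _)); apply/bigmax_leqP => i _.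
by rewrite (leq_trans (size_scale_leq _ _)) // size_node_sqr.
Qed.

(** Fix one node r i0.  Weights equal to 1 at all indices of the other nodes and
    a single free weight at i0 give the members of the pencil p + c q where
    q is the squared product over the other nodes.  At a node r j different from
    r i0, all terms of p vanish but those of index i with r i = r j, which
    are equal and nonzero; so p and q are coprime. *)
Lemma separable_secular_point : (1 < size S)%N ->
  exists w, (secular_poly w)`_d != 0 /\ separable_poly (secular_poly w).
Proof.
move=> S1.
have [i0 _] : exists i0 : 'I_n, true.
  case: n r S1 => [r' |n' r' _]; last by exists ord0.
  by rewrite ltnNge (leq_trans (size_undup _)) // size_codom card_ord.
pose p : {poly K} := \sum_(i | r i != r i0) r i *: node_poly (r i) ^+ 2.
pose q := node_poly (r i0) ^+ 2.
have pq : coprimep p q.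
  rewrite coprimep_sym; apply/Pdiv.ClosedField.coprimepP => z.
  rewrite root_exp // => [|]; last exact: mulrC.
  rewrite root_node mem_undup => /andP[zNi0 /codomP[j zE]].
  rewrite horner_sum (eq_bigr (fun i =>
    if r i == z then z * (node_poly z).[z] ^+ 2 else 0)); last first.
    move=> i _; rewrite hornerZ horner_exp; case: eqP => [->//|/eqP riNz].
    have : root (node_poly (r i)) z by rewrite root_node eq_sym riNz zE mem_nodes.
    by move/rootP->; rewrite expr0n mulr0.
  rewrite -big_mkcondr sumr_const mulrn_eq0 negb_or mulf_neq0 ?andbT //.
  - rewrite -lt0n; apply/card_gt0P; exists j.
    by rewrite unfold_in /= -zE zNi0 eqxx.
  - by rewrite zE.
  - by rewrite expf_neq0 // -rootE root_node eqxx.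
have q1 : (1 < size q)%N.
  by rewrite size_node_sqr ltnS muln_gt0 /= -ltnS prednK // ltnW.
have [bad badP] := pencil_separable pq q1.
(* Excluding - p_d as well keeps the degree of p + c q equal to d. *)
have [c] := notin_seq_exists (- p`_d :: bad).
rewrite inE negb_or => /andP[cNp /badP sep].
pose w := \row_i (if r i != r i0 then 1 else if i == i0 then sqrtC (c / r i0) else 0).
exists w; suff -> : secular_poly w = p + c *: q.
  by split=> //; rewrite coefD coefZ coef_node_sqr mulr1 addrC addr_eq0.
rewrite /secular_poly (bigID (fun i => r i != r i0)) /=; congr (_ + _).
  by apply: eq_bigr => i riN; rewrite mxE riN expr1n mulr1.
rewrite (bigD1 i0) /= ?eqxx // big1 => [|i /andP[/negbNE/eqP ri iN]].
  by rewrite addr0 mxE !eqxx /= sqrtCK mulrC mulfVK.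
by rewrite mxE ri eqxx (negPf iN) expr0n mulr0 scale0r.
Qed.

(** If the node r i is a root, the total weight on this node is zero, so the
    whole polynomial is divisible by (X - r i)^2 and has a double root. *)
Lemma separable_secular_root w i :
  separable_poly (secular_poly w) -> ~~ root (secular_poly w) (r i).
Proof.
rewrite unlock => /Pdiv.ClosedField.coprimepP sep; apply/negP => ri_root.
have node0 j : r j != r i -> (node_poly (r j)).[r i] = 0.
  by move=> rji; apply/rootP; rewrite root_node eq_sym rji mem_nodes.
have nodeN0 : (node_poly (r i)).[r i] != 0 by rewrite -rootE root_node eqxx.
pose c := \sum_(j | r j == r i) r j * w 0 j ^+ 2.
have c0 : c = 0.
  apply: (mulIf (expf_neq0 2 nodeN0)); rewrite mul0r -[RHS](rootP ri_root).
  rewrite /secular_poly horner_sum (bigID (fun j => r j == r i)) /=.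
  rewrite [X in _ + X]big1 => [|j rj]; last first.
    by rewrite hornerZ horner_exp node0 // expr0n mulr0.
  rewrite addr0 mulr_suml; apply: eq_bigr => j /eqP rj.
  by rewrite hornerZ horner_exp rj.
have /eqP := sep _ ri_root; apply.
rewrite /secular_poly (raddf_sum (@deriv _)) horner_sum (bigID (fun j => r j == r i)) /=.
rewrite [X in _ + X]big1 => [|j rj]; last first.
  by rewrite derivZ deriv_exp !hornerE node0 // !(mulr0, addr0).
rewrite addr0 -[RHS](mul0r ((node_poly (r i) ^+ 2)^`().[r i])) -[in RHS]c0 mulr_suml.
by apply: eq_bigr => j /eqP rj; rewrite derivZ hornerZ rj.
Qed.

(** The secular polynomial with indeterminate weights: its discriminant is the
    polynomial in w whose nonvanishing makes w general. *)
Definition generic_secular_poly : {poly {mpoly K[n]}} :=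
  \sum_i (r i *: 'X_i ^+ 2) *: map_poly (@mpolyC n K) (node_poly (r i) ^+ 2).

Lemma meval_secular w :
  map_poly (meval (w 0)) generic_secular_poly = secular_poly w.
Proof.
rewrite /generic_secular_poly rmorph_sum; apply: eq_bigr => i _ /=.
rewrite map_polyZ -map_poly_comp /= mevalZ rmorphXn /= mevalXU.
by congr (_ *: _); rewrite map_poly_id // => c _ /=; rewrite mevalC.
Qed.

Lemma size_generic_secular : (size generic_secular_poly <= d.+1)%N.
Proof.
apply: (leq_trans (size_sum _ _ _)); apply/bigmax_leqP => i _.
rewrite (leq_trans (size_scale_leq _ _)) // (leq_trans (size_poly _ _)) //.
by rewrite size_node_sqr.
Qed.

(** The general w is defined by the nonvanishing of its coordinates, of the
    coefficient of degree d, and of the resultant of the generic secular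
    polynomial with its derivative.  The last two are nonzero polynomials since
    they do not vanish at the point given by [separable_secular_point]. *)
Lemma generic_secular_separable : (1 < size S)%N ->
  holds_generically (fun w => [/\ forall i, w 0 i != 0,
    size (secular_poly w) = d.+1 & separable_poly (secular_poly w)]).
Proof.
move=> S1; pose P := generic_secular_poly; pose L := P`_d.
have d_gt0 : (0 < d)%N by rewrite muln_gt0 /= -ltnS prednK // ltnW.
have LE w : L.@[w 0] = (secular_poly w)`_d by rewrite -meval_secular coef_map.
have resE w : L.@[w 0] != 0 ->
    (resultant P P^`()).@[w 0] = resultant (secular_poly w) (secular_poly w)^`().
  move=> Lw; have LN0 : L != 0 by apply: contraNneq Lw => ->; rewrite meval0.
  have sP : size P = d.+1.
    apply/eqP; rewrite eqn_leq size_generic_secular ltnNge.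
    by apply: contra LN0 => /leq_sizeP/(_ d (leqnn _))/eqP.
  have P'd : P^`()`_d.-1 = L *+ d by rewrite coef_deriv prednK.
  have LdN0 : (L *+ d).@[w 0] != 0.
    by rewrite mevalMn mulrn_eq0 negb_or -lt0n d_gt0.
  have sP' : size P^`() = d.
    apply/eqP; rewrite eqn_leq -ltnS -sP lt_size_deriv /=; last first.
      by rewrite -size_poly_gt0 sP.
    rewrite -(ltn_predK d_gt0) ltnNge; apply: contra LdN0.
    by move=> /leq_sizeP/(_ _ (leqnn _)); rewrite P'd => ->; rewrite meval0.
  have szE (p : {poly {mpoly K[n]}}) : (lead_coef p).@[w 0] != 0 ->
      size (map_poly (meval (w 0)) p) = size p.
    by move=> pw; rewrite size_map_poly_id0.
  rewrite -meval_secular deriv_map resultant_map_poly // szE //.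
    by rewrite lead_coefE sP.
  by rewrite lead_coefE sP' P'd.
have res_sep w : L.@[w 0] != 0 ->
    (resultant (secular_poly w) (secular_poly w)^`() != 0) =
    separable_poly (secular_poly w).
  rewrite LE => Lw; rewrite resultant_eq0 unlock coprimep_def -leqNgt eqn_leq.
  rewrite size_poly_gt0 gcdp_eq0 negb_and.
  suff -> : secular_poly w != 0 by rewrite andbT.
  by apply: contraNneq Lw => ->; rewrite coef0.
have [w0 [Lw0 sep0]] := separable_secular_point S1; rewrite -LE in Lw0.
exists ((\prod_i 'X_i) * L * resultant P P^`()).
  rewrite !mulf_neq0 //.
  - apply/prodf_neq0 => i _; apply/eqP => /(congr1 (meval (fun=> 1))).
    by rewrite mevalXU meval0 => /eqP; rewrite oner_eq0.
  - by apply: contraNneq Lw0 => ->; rewrite meval0.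
  - have : resultant (secular_poly w0) (secular_poly w0)^`() != 0 by rewrite res_sep.
    by rewrite -resE //; apply: contraNneq => ->; rewrite meval0.
move=> w; rewrite !mevalM !mulf_eq0 !negb_or -andbA => /and3P[Xw Lw Rw]; split.
- move=> i; move: Xw; rewrite rmorph_prod /= => /prodf_neq0/(_ i isT).
  by rewrite mevalXU.
- apply/eqP; rewrite eqn_leq size_secular ltnNge; apply: contra Lw.
  by move=> /leq_sizeP/(_ d (leqnn _)); rewrite LE => ->.
- by rewrite -res_sep // -resE.
Qed.

End SecularPolynomial.

(** * Critical points in diagonal coordinates *)

(** Clearing denominators: y_i = r_i w_i / (r_i - l) for l different from r_i,
    but the product form also covers the value of l at a node. *)
Lemma secular_horner (K : numClosedFieldType) n (r : 'I_n -> K) (w y : 'rV[K]_n) l :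
    (forall i, r i != 0) -> (forall i, y 0 i * (r i - l) = r i * w 0 i) ->
  (secular_poly r w).[l] =
    (\prod_(s <- undup (codom r)) ('X - s%:P)).[l] ^+ 2
      * \sum_i (r i)^-1 * y 0 i ^+ 2.
Proof.
move=> rN0 yE; rewrite /secular_poly horner_sum mulr_sumr; apply: eq_bigr => i _.
rewrite hornerZ horner_exp (perm_big _ (perm_to_rem (mem_nodes r i))) big_cons /=.
rewrite hornerM hornerXsubC -/(node_poly r (r i)).
have {}yE : r i * w 0 i ^+ 2 = (r i)^-1 * (l - r i) ^+ 2 * y 0 i ^+ 2.
  apply: (mulfI (rN0 i)); rewrite mulrA -expr2 -exprMn -yE.
  by field.
by rewrite yE; ring.
Qed.

Lemma card_seq_set (T : eqType) (s : seq T) :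
  uniq s -> ([set` s] #= `I_(size s))%card.
Proof.
move=> s_uniq; apply/card_set_bijP; exists (index^~ s); split.
- by move=> x /=; rewrite index_mem.
- by move=> x y /set_mem xs /set_mem ys; apply: index_inj.
- move=> k /= ks; case: s s_uniq ks => // x s s_uniq ks.
  by exists (nth x (x :: s) k); [exact: mem_nth | rewrite index_uniq].
Qed.

(** For general w, the critical points are parametrized by their multiplier:
    l |-> (w_i / (1 + l a_i))_i is a bijection from the roots of the secular
    polynomial with nodes r_i = - 1 / a_i to the critical points.  Injectivity
    and the fact that 1 + l a_i never vanishes use that all w_i are nonzero. *)
Lemma diagonal_critical_card (K : numClosedFieldType) n (a : 'I_n -> K) :
    (forall i, a i != 0) -> (1 < size (undup (codom a)))%N ->
  holds_generically (fun w : 'rV[K]_n =>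
    [set y : 'rV[K]_n | [/\ y != 0, \sum_i a i * y 0 i ^+ 2 = 0 &
       exists l, forall i, w 0 i - y 0 i = l * (a i * y 0 i)]]
    #= `I_(2 * (size (undup (codom a))).-1))%card.
Proof.
move=> aN0 a2; pose r i := - (a i)^-1.
have rN0 i : r i != 0 by rewrite oppr_eq0 invr_eq0.
have aE i : a i = - (r i)^-1 by rewrite /r invrN opprK invrK.
have sE : size (undup (codom r)) = size (undup (codom a)).
  rewrite -[RHS](size_map (fun z => - z^-1)) -undup_map_inj; last first.
    by move=> x y /oppr_inj/invr_inj.
  by congr (size (undup _)); exact: (map_comp (fun z => - z^-1) a).
have {a2} r2 : (1 < size (undup (codom r)))%N by rewrite sE.
rewrite -sE; clearbody r.
have i0 : 'I_n.
  case: n a r {aN0 rN0 aE sE} r2 => [|n] a r r2; last exact: ord0.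
  by rewrite ltnNge (leq_trans (size_undup _)) // size_codom card_ord in r2.
have [D DN0 Dw] := generic_secular_separable rN0 r2.
exists D => // w /Dw[wN0 szP sepP].
have [rs PE] := closed_field_poly_normal (secular_poly r w).
have PN0 : secular_poly r w != 0 by rewrite -size_poly_gt0 szP.
have lcN0 : lead_coef (secular_poly r w) != 0 by rewrite lead_coef_eq0.
have rsP l : (l \in rs) = root (secular_poly r w) l.
  by rewrite PE rootZ // root_prod_XsubC.
have rs_uniq : uniq rs.
  rewrite -separable_prod_XsubC.
  by apply: dvdp_separable sepP; rewrite [X in _ %| X]PE dvdpZr.
have szrs : size rs = (2 * (size (undup (codom r))).-1)%N.
  by move: szP; rewrite PE size_scale // size_prod_XsubC => -[].
have rs_node l i : l \in rs -> r i - l != 0.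
  rewrite rsP => l_root; rewrite subr_eq0; apply: contraTneq l_root => <-.
  exact: separable_secular_root.
pose phi l : 'rV[K]_n := \row_i (r i * w 0 i / (r i - l)).
have phiE l i : l \in rs -> phi l 0 i * (r i - l) = r i * w 0 i.
  by move=> /(rs_node _ i) h; rewrite mxE mulfVK.
have sumE (y : 'rV[K]_n) : \sum_i a i * y 0 i ^+ 2 = - \sum_i (r i)^-1 * y 0 i ^+ 2.
  by rewrite -sumrN; apply: eq_bigr => i _; rewrite aE mulNr.
rewrite -szrs -(size_map phi) (_ : mkset _ = [set` map phi rs]).
  apply: card_seq_set; rewrite map_inj_in_uniq // => l l' lrs l'rs phill'.
  have phiN0 : phi l 0 i0 != 0.
    by rewrite mxE !mulf_neq0 ?invr_eq0 ?rs_node.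
  have := phiE l i0 lrs; rewrite -(phiE l' i0 l'rs) -phill' => /(mulfI phiN0).
  by move/addrI/oppr_inj.
apply/seteqP; split=> [y [yN0 yy [l yl]]|y /mapP[l lrs ->]] /=.
  have yE i : y 0 i * (r i - l) = r i * w 0 i.
    have -> : w 0 i = y 0 i + l * (a i * y 0 i) by rewrite -yl addrC subrK.
    by rewrite aE; field; rewrite rN0.
  have lNr i : r i - l != 0.
    apply: contraTneq (mulf_neq0 (rN0 i) (wN0 i)) => rl.
    by rewrite -yE rl mulr0 eqxx.
  apply/mapP; exists l.
    rewrite rsP rootE (secular_horner rN0 yE) mulf_eq0; apply/orP; right.
    by rewrite -oppr_eq0 -sumE yy.
  by apply/rowP => i; rewrite mxE -yE mulfK.
split.
- apply/eqP => /rowP/(_ i0)/eqP; rewrite !mxE; apply/negP.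
  by rewrite !mulf_neq0 ?invr_eq0 ?rs_node.
- apply/eqP; rewrite sumE oppr_eq0; have := lrs.
  rewrite rsP rootE (secular_horner rN0 (fun i => phiE l i lrs)) mulf_eq0.
  rewrite expf_eq0 /= => /orP[|//].
  rewrite -rootE root_prod_XsubC mem_undup => /codomP[i li].
  by have := rs_node l i lrs; rewrite li subrr eqxx.
- exists l => i; apply: (mulIf (rs_node l i lrs)).
  rewrite aE mulrBl phiE // mulrA -[RHS]mulrA phiE //.
  by field; rewrite rN0.
Qed.

Lemma holds_generically_and (K : fieldType) n (P P' : 'rV[K]_n -> Prop) :
  holds_generically P -> holds_generically P' -> holds_generically (fun u => P u /\ P' u).
Proof.
move=> [D DN0 DP] [D' D'N0 D'P]; exists (D * D'); first by rewrite mulf_neq0.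
by move=> u; rewrite mevalM mulf_eq0 negb_or => /andP[/DP ? /D'P].
Qed.

Lemma holds_generically_ex (K : numFieldType) n (P : 'rV[K]_n -> Prop) :
  holds_generically P -> exists u, P u.
Proof. by move=> [D /mpoly_nonvanishing[u Du] DP]; exists u; apply: DP. Qed.

(** The pullback of a nonzero polynomial by an invertible linear map is
    nonzero. *)
Lemma holds_generically_linear (K : numFieldType) n (M : 'M[K]_n) (P : 'rV[K]_n -> Prop) :
  M \in unitmx -> holds_generically P -> holds_generically (fun u => P (u *m M)).
Proof.
move=> Mu [D /mpoly_nonvanishing[u0 Du0] DP].
pose L := [tuple \sum_j M j i *: 'X_j : {mpoly K[n]} | i < n].
have LE (u : 'rV[K]_n) : (D \mPo L).@[u 0] = D.@[(u *m M) 0].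
  rewrite comp_mpoly_meval; apply: meval_eq => i.
  rewrite tnth_mktuple (raddf_sum (meval _)) mxE; apply: eq_bigr => j _ /=.
  by rewrite mevalZ mevalXU mulrC.
exists (D \mPo L) => [|u]; last by rewrite LE => /DP.
have : (D \mPo L).@[(u0 *m invmx M) 0] != 0 by rewrite LE mulmxKV.
by apply: contraNneq => ->; rewrite meval0.
Qed.

(** Two nonempty Zariski open sets meet, so the general number of critical
    points is unique. *)
Lemma EDdegree_eq (R : realType) n (Q : 'M[R]_n) Z d :
  is_EDdegree Q Z d -> EDdegree Q Z = d.
Proof.
move=> Qd; apply: xget_subset1 => // k k' Qk Qk'.
have [u [uk uk']] := holds_generically_ex (holds_generically_and Qk Qk').
by apply/card_eq_II/(card_eq_trans _ uk'); rewrite card_eq_sym.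
Qed.

Lemma bilin_congruence (K : fieldType) n (A M : 'M[K]_n) x y :
  bilin (M *m A *m M^T) x y = bilin A (x *m M) (y *m M).
Proof. by rewrite /bilin trmx_mul !mulmxA. Qed.

Lemma bilin_diag (K : fieldType) n (d y : 'rV[K]_n) :
  bilin (diag_mx d) y y = \sum_i d 0 i * y 0 i ^+ 2.
Proof.
rewrite /bilin mxE; apply: eq_bigr => i _.
by rewrite mul_mx_diag !mxE; ring.
Qed.

Lemma size_undup_codom_inj (U V : eqType) n (f : U -> V) (g : 'I_n -> U) :
  injective f -> size (undup (codom (f \o g))) = size (undup (codom g)).
Proof.
by move=> f_inj; rewrite -[RHS](size_map f) -undup_map_inj // codomE map_comp.
Qed.

(** The change of coordinates u = w M, x = y M reduces this to the diagonal
    case; multiplying the equation on the right by M^T exhibits the two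
    congruent forms. *)
Lemma pencil_critical_card (K : numClosedFieldType) n (A Q M : 'M[K]_n)
    (a : 'I_n -> K) :
    M *m Q *m M^T = 1%:M -> M *m A *m M^T = diag_mx (\row_i a i) ->
    (forall i, a i != 0) -> (1 < size (undup (codom a)))%N ->
  holds_generically (fun u : 'rV[K]_n =>
    [set x : 'rV[K]_n | [/\ x != 0, bilin A x x = 0 &
       exists l, (u - x) *m Q = l *: (x *m A)]]
    #= `I_(2 * (size (undup (codom a))).-1))%card.
Proof.
move=> MQ MA aN0 a2.
have [Mu _] : M \in unitmx /\ Q *m M^T \in unitmx.
  by apply: mulmx1_unit; rewrite mulmxA.
have Miu : invmx M \in unitmx by rewrite unitmx_inv.
have bilinE (y : 'rV[K]_n) : bilin A (y *m M) (y *m M) = \sum_i a i * y 0 i ^+ 2.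
  rewrite -bilin_congruence MA bilin_diag.
  by apply: eq_bigr => i _; rewrite [(\row_ _ _) _ _]mxE.
have critE (w y : 'rV[K]_n) l : (w *m M - y *m M) *m Q = l *: (y *m M *m A) <->
    forall i, w 0 i - y 0 i = l * (a i * y 0 i).
  have -> : (w *m M - y *m M) *m Q = l *: (y *m M *m A) <->
      w - y = l *: (y *m diag_mx (\row_i a i)).
    have <- : (w *m M - y *m M) *m Q *m M^T = w - y.
      by rewrite -mulmxBl -!mulmxA [M *m _]mulmxA MQ mulmx1.
    have <- : l *: (y *m M *m A) *m M^T = l *: (y *m diag_mx (\row_i a i)).
      by rewrite -scalemxAl -MA !mulmxA.
    have MtK : cancel (mulmx^~ M^T : 'rV[K]_n -> _) (mulmx^~ (invmx M^T)).
      by move=> z; rewrite mulmxK // unitmx_tr.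
    by split=> [->|/(can_inj MtK)].
  have diagE i : (y *m diag_mx (\row_i a i)) 0 i = a i * y 0 i.
    by rewrite mul_mx_diag !mxE mulrC.
  split=> [wy i|wy].
    by move/rowP/(_ i): wy; rewrite [LHS]mxE [X in _ + X]mxE [RHS]mxE diagE.
  by apply/rowP => i; rewrite [RHS]mxE diagE -wy [LHS]mxE [X in _ + X]mxE.
have [D DN0 DP] := holds_generically_linear Miu (diagonal_critical_card aN0 a2).
exists D => // u /DP; apply: card_eq_trans.
set E := (X in (_ #= X)%card).
rewrite (_ : mkset _ = (fun y => y *m M) @` E).
  by apply: inj_card_eq => y z _ _; apply: (can_inj (mulmxK Mu)).
apply/seteqP; split=> [x [xN0 xx [l ul]]|_ [y [yN0 yy [l wy]] <-]].
  exists (x *m invmx M); last by rewrite mulmxKV.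
  split.
  - by apply: contra xN0 => /eqP x0; rewrite -[x](mulmxKV Mu) x0 mul0mx.
  - by rewrite -bilinE mulmxKV.
  - by exists l; apply/critE; rewrite !mulmxKV.
split; last by exists l; move/critE: wy; rewrite mulmxKV.
  by apply: contra yN0 => /eqP y0; rewrite -[y](mulmxK Mu) y0 mul0mx.
by rewrite bilinE.
Qed.

Lemma EDdegree_diagonalized (R : realType) n (A Q M : 'M[R]_n) (d : 'rV[R]_n) :
    A^T = A -> M *m Q *m M^T = 1%:M -> M *m A *m M^T = diag_mx d ->
    A \in unitmx -> (forall i, d 0 i != 0) -> (1 < size (undup (codom (d 0%R))))%N ->
    (exists2 x : 'rV[R[i]]_n, x != 0 & bilin (complexify_form A) x x = 0) ->
  EDdegree Q (zero_locus (quadratic_mpoly (complexify_form A)))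
    = (2 * (size (undup (codom (d 0%R)))).-1)%N.
Proof.
move=> As MQ MA Au dN0 d2 iso; apply: EDdegree_eq.
pose a := real_complex R \o d 0.
have aE : size (undup (codom a)) = size (undup (codom (d 0))).
  have fI : injective (real_complex R) := @fmorph_inj _ _ (real_complex R).
  exact: size_undup_codom_inj fI.
have [] := @pencil_critical_card R[i] n (complexify_form A) (complexify_form Q)
   (complexify_form M) a.
- by rewrite /complexify_form map_trmx -!map_mxM MQ map_mx1.
- rewrite /complexify_form map_trmx -!map_mxM MA map_diag_mx.
  by congr diag_mx; apply/rowP => i; rewrite !mxE.
- by move=> i; rewrite fmorph_eq0.
- by rewrite aE.
move=> D DN0 DP; exists D => // u /DP; rewrite aE.
congr (is_true (_ #= _)%card); apply/seteqP.
by split=> x; rewrite /= ED_critical_points_quadric //;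
  rewrite /complexify_form ?map_trmx ?As ?map_unitmx.
Qed.

(** * Real quadrics *)

Lemma diagonal_isotropic0 (R : realFieldType) n (d y : 'rV[R]_n) :
  (forall i, 0 < d 0 i) -> \sum_i d 0 i * y 0 i ^+ 2 = 0 -> y = 0.
Proof.
move=> d_gt0 /eqP; rewrite psumr_eq0 => [/allP y0|i _]; last first.
  by rewrite mulr_ge0 ?sqr_ge0 // ltW.
apply/rowP => i; have := y0 i (mem_index_enum i).
by rewrite mulf_eq0 gt_eqF //= sqrf_eq0 mxE => /eqP.
Qed.

(** A definite diagonal form has no nonzero isotropic vector. *)
Lemma isotropic_signs (R : realFieldType) n (d y : 'rV[R]_n) :
    (forall i, d 0 i != 0) -> y != 0 -> \sum_i d 0 i * y 0 i ^+ 2 = 0 ->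
  (exists i, 0 < d 0 i) /\ (exists i, d 0 i < 0).
Proof.
move=> dN0 yN0 yy; split; apply: contrapT => /forallNP h.
- have /eqP := yN0; apply; apply: (@diagonal_isotropic0 _ _ (- d)) => [i|].
    by have /negP := h i; rewrite mxE oppr_gt0 -leNgt lt_neqAle dN0.
  apply: oppr_inj; rewrite oppr0 -[RHS]yy -sumrN; apply: eq_bigr => i _.
  by rewrite mxE mulNr opprK.
- have /eqP := yN0; apply; apply: (@diagonal_isotropic0 _ _ d) => // i.
  by have /negP := h i; rewrite -leNgt lt_neqAle eq_sym dN0.
Qed.

Lemma inner_product_gram_inv (R : realType) n (M : 'M[R]_n) :
  M \in unitmx -> inner_products (invmx M *m (invmx M)^T).
Proof.
move=> Mu; split=> [|x xN0]; first by rewrite trmx_mul trmxK.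
have -> : bilin (invmx M *m (invmx M)^T) x x = \sum_i (x *m invmx M) 0 i ^+ 2.
  rewrite /bilin -!mulmxA -trmx_mul mulmxA mxE; apply: eq_bigr => i _.
  by rewrite [_^T _ _]mxE.
rewrite lt_neqAle sumr_ge0 ?andbT => [|i _]; last exact: sqr_ge0.
apply: contra xN0; rewrite eq_sym psumr_eq0 => [/allP y0|i _]; last exact: sqr_ge0.
suff : x *m invmx M = 0 by move=> xM; rewrite -[x](mulmxKV Mu) xM mul0mx.
apply/rowP => i; have := y0 i (mem_index_enum i).
by rewrite sqrf_eq0 => /eqP ->; rewrite mxE.
Qed.

Lemma inner_products1 (R : realType) n : inner_products (1%:M : 'M[R]_n).
Proof.
by have := inner_product_gram_inv (unitmx1 R n); rewrite invmx1 trmx1 mulmx1.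
Qed.

(** Positive factors can only merge entries of the same sign.  The indices i0
    and i1 provide the two values 1 and - 1; k - 2 other indices i receive the
    pairwise distinct absolute values i + 2, and all remaining entries are
    1 or - 1. *)
Lemma signed_values (R : realFieldType) n (s : 'I_n -> R) k (i0 i1 : 'I_n) :
    (forall i, `|s i| = 1) -> s i0 = 1 -> s i1 = -1 -> (1 < k <= n)%N ->
  exists b : 'I_n -> R, (forall i, 0 < b i) /\
    size (undup (codom (fun i => s i * b i))) = k.
Proof.
move=> s1 si0 si1 /andP[k2 kn].
have i01 : i1 != i0.
  by apply: contraTneq isT => i01; move: si0; rewrite -i01 si1; lra.
pose T := take k.-2 (enum (~: [set i0; i1])).
have T_uniq : uniq T by rewrite take_uniq // enum_uniq.
have sizeT : size T = k.-2.
  rewrite size_takel // -cardE cardsCs finset.setCK card_ord cards2 eq_sym i01.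
  by rewrite -subn2 leq_sub2r.
have TN i : i \in T -> (i != i0) && (i != i1).
  by move/mem_take; rewrite mem_enum !inE negb_or.
pose b i : R := if i \in T then i%:R + 2 else 1.
have b_gt0 i : 0 < b i.
  by rewrite /b; case: ifP => // _; rewrite ltr_wpDl ?ler0n.
exists b; split=> //; pose f i := s i * b i.
have absf i : `|f i| = b i by rewrite normrM s1 mul1r gtr0_norm.
have f0 : f i0 = 1.
  by rewrite /f /b ifN ?si0 ?mul1r //; apply/negP => /TN; rewrite eqxx.
have f1 : f i1 = -1.
  by rewrite /f /b ifN ?si1 ?mulr1 //; apply/negP => /TN; rewrite eqxx andbF.
have fT i : i \in T -> `|f i| != 1.
  move=> iT; rewrite absf /b iT gt_eqF //.
  by have := ler0n R i; lra.
have list_uniq : uniq [:: 1, -1 & map f T].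
  rewrite /= inE negb_or; apply/andP; split; [apply/andP; split|apply/andP; split].
  - by rewrite gt_eqF //; lra.
  - by apply/mapP => -[i /fT]; move=> h e; rewrite -e normr1 eqxx in h.
  - by apply/mapP => -[i /fT]; move=> h e; rewrite -e normrN1 eqxx in h.
  - rewrite map_inj_in_uniq // => i j iT jT /(congr1 Num.norm).
    rewrite !absf /b iT jT => /addIr/eqP; rewrite eqr_nat => /eqP; exact: val_inj.
have -> : k = size [:: 1, -1 & map f T].
  by rewrite /= size_map sizeT -addn2 -subn2 subnK.
apply/perm_size/uniq_perm => //; first exact: undup_uniq.
move=> z; rewrite mem_undup !inE; apply/codomP/idP => [[i ->]|].
  rewrite -/(f i); have [iT|iNT] := boolP (i \in T).
    by rewrite map_f ?orbT.
  have : (s i == 1) || (s i == -1).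
    by have := s1 i; case: (ger0P (s i)) => _ si; rewrite -?eqr_oppLR si eqxx ?orbT.
  by rewrite /f /b (negPf iNT) mulr1 => /orP[]->; rewrite ?orbT.
by case/or3P => [/eqP->|/eqP->|/mapP[i _ ->]]; [exists i0|exists i1|exists i].
Qed.

(** A vector in the kernel of A is a singular point of the quadric. *)
Lemma smooth_quadric_unit (K : numFieldType) n (A : 'M[K]_n) :
  A^T = A -> smooth_hypersurface (quadratic_mpoly A) -> A \in unitmx.
Proof.
move=> As sm; rewrite -row_free_unit -kermx_eq0; apply/rowV0P => x /sub_kermxP xA0.
apply/eqP; apply: contraT => xN0.
have := sm x xN0; rewrite meval_quadratic quadratic_gradient // /bilin xA0.
by rewrite mul0mx mxE scaler0 eqxx => /(_ erefl).
Qed.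

Section RealQuadric.
Variables (R : realType) (n : nat) (A : 'M[R]_n) (x : 'rV[R]_n).
Hypotheses (A_sym : A^T = A) (A_unit : A \in unitmx).
Hypotheses (x_neq0 : x != 0) (x_iso : bilin A x x = 0).

Local Notation CX := (zero_locus (quadratic_mpoly (complexify_form A))).

Lemma diagonal_signs (M : 'M[R]_n) d : M \in unitmx -> M *m A *m M^T = diag_mx d ->
  [/\ forall i, d 0 i != 0, exists i, 0 < d 0 i & exists i, d 0 i < 0].
Proof.
move=> Mu MA.
have dN0 i : d 0 i != 0.
  have : M *m A *m M^T \in unitmx by rewrite !unitmx_mul unitmx_tr Mu A_unit.
  by rewrite MA unitmxE det_diag unitfE => /prodf_neq0/(_ i isT).
have yN0 : x *m invmx M != 0.
  by apply: contra x_neq0 => /eqP y0; rewrite -[x](mulmxKV Mu) y0 mul0mx.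
have yy := bilin_congruence A M (x *m invmx M) (x *m invmx M).
rewrite MA mulmxKV // x_iso bilin_diag in yy.
by have [] := isotropic_signs dN0 yN0 yy.
Qed.

Lemma EDdegree_real_quadric (Q M : 'M[R]_n) d :
    M *m Q *m M^T = 1%:M -> M *m A *m M^T = diag_mx d ->
  (1 < size (undup (codom (d 0%R))))%N /\
  EDdegree Q CX = (2 * (size (undup (codom (d 0%R)))).-1)%N.
Proof.
move=> MQ MA.
have [Mu _] : M \in unitmx /\ Q *m M^T \in unitmx.
  by apply: mulmx1_unit; rewrite mulmxA.
have [dN0 [i di] [j dj]] := diagonal_signs Mu MA.
have d2 : (1 < size (undup (codom (d 0%R))))%N.
  have ij : uniq [:: d 0 i; d 0 j].
    by rewrite /= inE andbT; apply: contraTneq dj => <-; rewrite -leNgt ltW.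
  apply: (uniq_leq_size ij) => z; rewrite !inE mem_undup.
  by case/orP => /eqP ->; apply: codom_f.
split=> //; apply: (EDdegree_diagonalized A_sym MQ MA) => //.
exists (map_mx (real_complex R) x); first by rewrite map_mx_eq0.
by rewrite /bilin /complexify_form map_trmx -!map_mxM mxE -/(bilin A x x) x_iso rmorph0.
Qed.

Lemma EDdegree_inner_product Q : inner_products Q ->
  exists2 k, (1 <= k <= n.-1)%N & EDdegree Q CX = (2 * k)%N.
Proof.
move=> [Qs Qpos]; have [M MQ [d MA]] := simultaneous_diagonalization A_sym Qs Qpos.
have [m2 ->] := EDdegree_real_quadric MQ MA.
exists (size (undup (codom (d 0%R)))).-1 => //.
have : (size (undup (codom (d 0%R))) <= n)%N.
  by rewrite (leq_trans (size_undup _)) // size_codom card_ord.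
by case: (size _) m2 => [|[|m]] //= _; case: n.
Qed.

(** Start from a basis M orthonormal for the standard inner product that
    diagonalizes A.  The rescaled basis P = diag(t) M is orthonormal for
    Q = P^-1 P^-T, and A has entries t_i^2 d_i in it; with t_i^2 = b_i / |d_i|
    these are sg(d_i) b_i, where b is chosen by [signed_values]. *)
Lemma EDdegree_attained k : (1 <= k <= n.-1)%N ->
  exists2 Q, inner_products Q & EDdegree Q CX = (2 * k)%N.
Proof.
move=> /andP[k1 kn].
have [|M MM [d MA]] := @simultaneous_diagonalization _ _ A 1%:M A_sym (trmx1 _ _).
  by have [] := inner_products1 R n.
have [Mu _] : M \in unitmx /\ M^T \in unitmx.
  by apply: mulmx1_unit; rewrite -MM mulmx1.
have [dN0 [i0 di0] [i1 di1]] := diagonal_signs Mu MA.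
have [||||b [b_gt0 bk]] := @signed_values R n (fun i => Num.sg (d 0 i)) k.+1 i0 i1.
- by move=> i; rewrite normr_sg dN0.
- by rewrite gtr0_sg.
- by rewrite ltr0_sg.
- by rewrite ltnS k1 -(ltn_predK (ltn_ord i0)).
pose t := \row_i Num.sqrt (b i / `|d 0 i|).
have tt i : t 0 i * d 0 i * t 0 i = Num.sg (d 0 i) * b i.
  have absd_neq0 : `|d 0 i| != 0 by rewrite normr_eq0.
  rewrite mxE mulrAC -expr2 sqr_sqrtr; last by rewrite divr_ge0 // ltW.
  by rewrite [X in _ * X]numEsg; field.
pose P := diag_mx t *m M.
have Pu : P \in unitmx.
  rewrite unitmx_mul Mu andbT unitmxE det_diag unitfE; apply/prodf_neq0 => i _.
  by rewrite mxE sqrtr_eq0 -ltNge divr_gt0 // normr_gt0.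
pose Q := invmx P *m (invmx P)^T.
exists Q; first exact: inner_product_gram_inv.
have PQ : P *m Q *m P^T = 1%:M.
  by rewrite /Q mulmxA mulmxV // mul1mx -trmx_mul mulmxV // trmx1.
have PA : P *m A *m P^T = diag_mx (\row_i (Num.sg (d 0 i) * b i)).
  have -> : P *m A *m P^T = diag_mx t *m (M *m A *m M^T) *m diag_mx t.
    by rewrite /P trmx_mul tr_diag_mx !mulmxA.
  rewrite MA.
  apply/matrixP => i j; rewrite mul_mx_diag mul_diag_mx !mxE.
  case: eqP => [<-|_]; last by rewrite !mulr0n mulr0 mul0r.
  by rewrite !mulr1n -tt !mxE.
have [_ ->] := EDdegree_real_quadric PQ PA.
rewrite -[k]/k.+1.-1 -bk; congr (2 * (size (undup _)).-1)%N.
by apply: eq_codom => i; rewrite mxE.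
Qed.

End RealQuadric.

Theorem corollary5p7 (R : realType) (N : nat) (F : {mpoly R[N.+1]})
    (F_quadratic : F \is 2.-homog)
    (X_smooth : smooth_hypersurface (complexify_poly F))
    (X_real_point : exists2 x : 'rV[R]_N.+1, x != 0 & F.@[x 0] = 0) :
  let CX := zero_locus (complexify_poly F) in
  [set EDdegree Q CX | Q in @inner_products R N.+1]
    = [set d : nat | exists2 k : nat, (1 <= k <= N)%N & d = (2 * k)%N]
  /\ ((exists2 Q, inner_products Q & EDdegree Q CX = 2%N) /\
      (forall Q, inner_products Q -> (2 <= EDdegree Q CX)%N)).
Proof.
have [A A_sym FA] := homog2_quadratic F_quadratic.
have FcA : complexify_poly F = quadratic_mpoly (complexify_form A).
  rewrite FA /complexify_poly /quadratic_mpoly rmorph_sum; apply: eq_bigr => i _ /=.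
  rewrite rmorph_sum; apply: eq_bigr => j _ /=.
  by rewrite map_mpolyZ rmorphM /= !map_mpolyX mxE.
have A_unit : A \in unitmx.
  rewrite -(map_unitmx (real_complex R)); apply: smooth_quadric_unit.
    by rewrite map_trmx A_sym.
  by rewrite -/(complexify_form A) -FcA.
have [x xN0 Fx] := X_real_point.
have xx : bilin A x x = 0 by rewrite -meval_quadratic -FA.
rewrite /= FcA.
have deg := EDdegree_inner_product A_sym A_unit xN0 xx.
have att := EDdegree_attained A_sym A_unit xN0 xx.
split; last split.
- apply/seteqP; split=> [_ [Q /deg[k kN ->] <-]|_ [k kN ->]].
    by exists k.
  by have [Q Qi QE] := att k kN; exists Q.
- have [k /andP[k1 kN] _] := deg _ (inner_products1 R N.+1).
  have [|Q Qi QE] := att 1%N; last by exists Q.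
  by rewrite (leq_trans k1 kN).
- by move=> Q /deg[k /andP[k1 _] ->]; rewrite mulnC -[2%N]mul1n leq_mul2r.
Qed.
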